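(* Let $\Phi_h$ and $\Psi_h$ be two splitting methods expanded in multi-index series with coefficient maps $\alpha_1,\alpha_2:\mathbb N^\infty\to\mathbb R$ respectively, i.e. $\Phi_h=e^{hA}B(\alpha_1)$ and $\Psi_h=e^{hA}B(\alpha_2)$. Then their composition can be expanded in a multi-index series with coefficient map $\alpha_2*\alpha_1$: $$\Phi_h\circ\Psi_h=e^{2hA}\,B(\alpha_2*\alpha_1),\qquad (\alpha_2*\alpha_1)(\mu):=\sum_{(\mu)}\alpha_2(\mu_{(1)})\,\alpha_1(\mu_{(2)})\quad\text{for all }\mu\in\mathbb N^\infty,$$ where $\Delta_\curvearrowright(\mu)=\sum_{(\mu)}\mu_{(1)}\otimes\mu_{(2)}$ (Sweedler notation, coefficient maps extended linearly) and $$\Delta_\curvearrowright(\mu)=\sum_{\substack{\mu_1\cdot\mu_2=\mu\\ p\in\mathbb N^{\#\mu_2}}}\binom{\mu_2}{p}\,\mu_1\otimes(\mu_2\setminus p).$$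
   Context: $\mathbb N$ contains $0$. $A,B$ are linear operators; operator exponentials and infinite sums are read as formal power series in the time step $h$ (e.g. $A,B$ are elements of a unital associative real algebra $\mathcal A$ and identities hold in $\mathcal A[[h]]$). $[X,Y]=XY-YX$; $\mathrm{ad}_X^0(Y)=Y$, $\mathrm{ad}_X^j(Y)=[X,\mathrm{ad}_X^{j-1}(Y)]$. A splitting method is an operator of the form $\Phi_h=e^{b_shB_s}e^{a_shA}\cdots e^{b_1hB_1}e^{a_1hA}$ with $a_j,b_j\in\mathbb R$, $\sum_ja_j=1$, where $B_j=B$ or, more generally, $B_j$ is $B$ plus a linear combination of nested commutators of $A$ and $B$ (a commutator with $m$ letters being multiplied by $h^{m-1}$). A multi-index is a finite tuple $\mu=(\mu_1,\dots,\mu_k)\in\mathbb N^k$, $k\ge0$ (empty one: $\mathbf 1$); the set of all is $\mathbb N^\infty$, spanning the real vector space $\mathcal M$; $\#\mu=k$, $\mu!=\prod_j\mu_j!$, $|\mu|=k+\sum_j\mu_j$. $\mathbb F(\mu)=h^{|\mu|}\mathrm{ad}_{-A}^{\mu_k}(B)\cdots\mathrm{ad}_{-A}^{\mu_1}(B)$, $\mathbb F(\mathbf 1)=\mathrm{id}$. Multi-index series: $B(\alpha)=\sum_{\mu\in\mathbb N^\infty}\frac{\alpha(\mu)}{\mu!}\mathbb F(\mu)$. In $\Delta_\curvearrowright$, the dot is concatenation and the sum is over all decompositions of $\mu$ into two (possibly empty) consecutive multi-indices $\mu_1,\mu_2$. For $p,\eta\in\mathbb N^k$: $\eta\setminus p=(\eta_1-p_1,\dots,\eta_k-p_k)$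 if $p_i\le\eta_i$ for all $i$, and $\eta\setminus p=0\in\mathcal M$ otherwise; $\binom{\eta}{p}=\prod_i\binom{\eta_i}{p_i}$. *)

(* Defs.v *)
From HB Require Import structures.
From mathcomp Require Import all_boot all_order all_algebra.
From mathcomp Require Import finmap boolp classical_sets functions cardinality.
From mathcomp Require Import fsbigop reals.
From mathcomp Require Import monalg.

Set Implicit Arguments.
Unset Strict Implicit.
Unset Printing Implicit Defensive.

Import GRing.Theory.

Local Open Scope classical_set_scope.
Local Open Scope ring_scope.

(* The algebra A[[h]]: a power series is its sequence of coefficients.  The
   ring structure declared below is the Cauchy product; it is keyed on the
   constant [fps] and is not the pointwise one of [nat -> A]. *)
Definition fps (A : Type) : Type := nat -> A.

HB.instance Definition _ (V : zmodType) :=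
  GRing.Zmodule.copy (fps V) (nat -> V).

HB.instance Definition _ (R : pzRingType) (V : lmodType R) :=
  GRing.Lmodule.copy (fps V) (nat -> V).

(* The term h^n a. *)
Definition fps_monom (A : nmodType) (n : nat) (a : A) : fps A :=
  fun m => if m == n then a else 0.

Definition fps_mul (A : pzRingType) (f g : fps A) : fps A :=
  fun n => \sum_(i < n.+1) f i * g (n - i)%N.

Section FpsAlgebra.
Variables (R : pzRingType) (A : algType R).
Implicit Types f g k : fps A.

Let trunc n f : {poly A} := \poly_(i < n.+1) f i.

Let fps_mul_trunc n m f g : (m <= n)%N ->
  fps_mul f g m = (trunc n f * trunc n g)`_m.
Proof.
move=> le_mn; rewrite coefM; apply: eq_bigr => i _.
have le_in : (i <= n)%N by apply: leq_trans le_mn; rewrite -ltnS.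
by rewrite !coef_poly !ltnS le_in (leq_trans (leq_subr i m) le_mn).
Qed.

Fact fps_mulA : associative (@fps_mul A).
Proof.
move=> f g k; apply/funext => n.
have E1 : fps_mul f (fps_mul g k) n = (trunc n f * (trunc n g * trunc n k))`_n.
  rewrite coefM; apply: eq_bigr => i _; rewrite coef_poly ltn_ord.
  by rewrite (@fps_mul_trunc n) ?leq_subr.
have E2 : fps_mul (fps_mul f g) k n = ((trunc n f * trunc n g) * trunc n k)`_n.
  rewrite coefM; apply: eq_bigr => i _; rewrite [in RHS]coef_poly ltnS leq_subr.
  by rewrite (@fps_mul_trunc n) // -ltnS.
by rewrite E1 E2 mulrA.
Qed.

Fact fps_mul1l : left_id (fps_monom 0 1) (@fps_mul A).
Proof.
move=> f; apply/funext => n; rewrite /fps_mul big_ord_recl /fps_monom /= mul1r.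
by rewrite big1 ?addr0 ?subn0 // => i _; rewrite mul0r.
Qed.

Fact fps_mul1r : right_id (fps_monom 0 1) (@fps_mul A).
Proof.
move=> f; apply/funext => n; rewrite /fps_mul big_ord_recr /fps_monom /=.
rewrite subnn eqxx mulr1 big1 ?add0r // => i _.
by rewrite subn_eq0 leqNgt ltn_ord mulr0.
Qed.

Fact fps_mulDl : left_distributive (@fps_mul A) (@GRing.add (fps A)).
Proof.
move=> f g k; apply/funext => n.
have -> : (fps_mul f k + fps_mul g k) n = fps_mul f k n + fps_mul g k n by [].
by rewrite -big_split; apply: eq_bigr => i _; exact: mulrDl.
Qed.

Fact fps_mulDr : right_distributive (@fps_mul A) (@GRing.add (fps A)).
Proof.
move=> f g k; apply/funext => n.
have -> : (fps_mul f g + fps_mul f k) n = fps_mul f g n + fps_mul f k n by [].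
by rewrite -big_split; apply: eq_bigr => i _; exact: mulrDr.
Qed.

Fact fps_oner_neq0 : fps_monom 0 1 != 0 :> fps A.
Proof.
apply/eqP => /(congr1 (fun f : fps A => f 0%N)) /eqP.
by rewrite /fps_monom eqxx (oner_eq0 A).
Qed.

HB.instance Definition _ := GRing.Zmodule_isNzRing.Build (fps A)
  fps_mulA fps_mul1l fps_mul1r fps_mulDl fps_mulDr fps_oner_neq0.

Fact fps_scaleAl (c : R) f g : c *: (f * g) = c *: f * g.
Proof.
apply/funext => n; rewrite /GRing.mul /= /fps_mul /GRing.scale /= scaler_sumr.
by apply: eq_bigr => i _; rewrite scalerAl.
Qed.

HB.instance Definition _ := GRing.Lmodule_isLalgebra.Build R (fps A) fps_scaleAl.

Fact fps_scaleAr (c : R) f g : c *: (f * g) = f * (c *: g).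
Proof.
apply/funext => n; rewrite /GRing.mul /= /fps_mul /GRing.scale /= scaler_sumr.
by apply: eq_bigr => i _; rewrite scalerAr.
Qed.

HB.instance Definition _ := GRing.Lalgebra_isAlgebra.Build R (fps A) fps_scaleAr.

End FpsAlgebra.

(* Infinite sum in A[[h]], coefficient by coefficient.  A coefficient to which
   infinitely many terms contribute is set to 0 by [\sum_(_ \in _)]; this never
   happens below, where [fps_exp] is only applied to multiples of h and where a
   multi-index mu contributes to a multi-index series in degree |mu| only. *)
Definition fps_sum (A : nmodType) (I : choiceType) (F : I -> fps A) : fps A :=
  fun n => \sum_(i \in [set: I]) F i n.

Definition fps_exp (R : realType) (A : algType R) (X : fps A) : fps A :=
  fps_sum (fun k : nat => (k`!%:R)^-1 *: X ^+ k).

Definition commutator (A : pzRingType) (X Y : A) : A := X * Y - Y * X.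

Definition ad (A : pzRingType) (X : A) (j : nat) (Y : A) : A :=
  iter j (commutator X) Y.

Section SplittingMethods.
Variables (R : realType) (Alg : algType R) (A B : Alg).

(* Brackets of A and B with a given number of letters. *)
Inductive nested_commutator : nat -> Alg -> Prop :=
| nested_letterA : nested_commutator 1 A
| nested_letterB : nested_commutator 1 B
| nested_bracket m n X Y : nested_commutator m X -> nested_commutator n Y ->
    nested_commutator (m + n) (commutator X Y).

(* B plus a linear combination of nested commutators of at least two letters. *)
Inductive modified_B : fps Alg -> Prop :=
| modified_B_id : modified_B (fps_monom 0 B)
| modified_B_add Bt (c : R) m X : modified_B Bt ->
    nested_commutator m X -> (1 < m)%N ->
    modified_B (Bt + c *: fps_monom m.-1 X).

(* With [rev_ord] the factor of index s - 1 is the leftmost one, i.e. the stage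
   of index 0 is applied first. *)
Definition splitting_method (Phi : fps Alg) : Prop :=
  exists (s : nat) (a b : 'I_s -> R) (Bs : 'I_s -> fps Alg),
    [/\ \sum_(j < s) a j = 1,
        forall j, modified_B (Bs j) &
        Phi = \prod_(j < s)
                (fps_exp (b (rev_ord j) *: (fps_monom 1 1 * Bs (rev_ord j)))
                 * fps_exp (a (rev_ord j) *: fps_monom 1 A))].

End SplittingMethods.

Definition multiindex : Type := seq nat.

HB.instance Definition _ := Countable.copy multiindex (seq nat).

Definition mi_weight (mu : multiindex) : nat := (size mu + sumn mu)%N.

Definition mi_fact (mu : multiindex) : nat := (\prod_(m <- mu) m`!)%N.

Section MultiIndexSeries.
Variables (R : realType) (Alg : algType R) (A B : Alg).

(* The product runs over [rev mu]: the factor of the last entry of mu is the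
   leftmost one. *)
Definition elem_diff (mu : multiindex) : fps Alg :=
  fps_monom (mi_weight mu) (\prod_(m <- rev mu) ad (- A) m B).

Definition mi_series (alpha : multiindex -> R) : fps Alg :=
  fps_sum (fun mu : multiindex =>
    (alpha mu / (mi_fact mu)%:R) *: elem_diff mu).

End MultiIndexSeries.

(* The space M with basis the multi-indices is {malg R[multiindex]}, and
   M (x) M is the space {malg R[multiindex * multiindex]} with basis the pairs
   (mu1, mu2), standing for mu1 (x) mu2. *)
Section Coproduct.
Variable R : realType.
Local Notation M := {malg R[multiindex]}.
Local Notation MM := {malg R[(multiindex * multiindex)%type]}.

Definition tens (x y : M) : MM :=
  \sum_(k <- msupp x) \sum_(l <- msupp y) << x@_k * y@_l *g (k, l) >>.

Definition mi_setminus (eta p : multiindex) : M :=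
  if all2 leq p eta then << [seq (x.1 - x.2)%N | x <- zip eta p] >> else 0.

(* For eta and p of the same length. *)
Definition mi_binom (eta p : multiindex) : nat :=
  (\prod_(x <- zip eta p) 'C(x.1, x.2))%N.

(* The decompositions of mu into two consecutive multi-indices are the pairs
   (take i mu, drop i mu) for 0 <= i <= #mu.  The sum over p has finite
   support, as [mi_setminus] vanishes unless p <= mu2. *)
Definition coproduct (mu : multiindex) : MM :=
  \sum_(i < (size mu).+1)
    let mu1 : multiindex := take i mu in
    let mu2 : multiindex := drop i mu in
    \sum_(p \in [set: (size mu2).-tuple nat])
      (mi_binom mu2 p)%:R *: tens << mu1 >> (mi_setminus mu2 p).

(* The linear map M (x) M -> R sending mu1 (x) mu2 to beta mu1 * alpha mu2. *)
Definition tens_eval (beta alpha : multiindex -> R) (x : MM) : R :=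
  \sum_(k <- msupp x) x@_k * (beta k.1 * alpha k.2).

Definition mi_convolution (beta alpha : multiindex -> R) (mu : multiindex) : R :=
  tens_eval beta alpha (coproduct mu).

End Coproduct.

(* Main.v *)
(* Since [Phi o Psi = e^(2hA) (e^(-hA) B(alpha1) e^(hA)) B(alpha2)], it suffices
   to expand a conjugate and a product of multi-index series.  Conjugation by
   [e^(hA)] is [e^(ad_{-hA})] on each letter [ad_{-A}^m B], so it raises the
   entries of a multi-index independently and produces the sum over p; the
   product of two elementary differentials concatenates multi-indices and
   produces the sum over the decompositions.  Both identities are proved
   coefficient by coefficient in h, splitting off the first entry of the
   multi-index. *)
Require Import Defs.
From HB Require Import structures.
From mathcomp Require Import all_boot all_order all_algebra.
From mathcomp Require Import finmap boolp classical_sets fsbigop reals monalg.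

Set Implicit Arguments.
Unset Strict Implicit.
Unset Printing Implicit Defensive.

Import GRing.Theory Num.Theory.

Local Open Scope ring_scope.

(** * Reindexing of finite sums over a triangle *)

Section TriangularSums.
Variables (V : nmodType) (n : nat) (F : nat -> nat -> V).

(** Raising [n] by one adds exactly the antidiagonal [i + j = n + 1]. *)
Lemma sum_antidiagonals :
  \sum_(i < n.+1) \sum_(j < (n - i).+1) F i j =
  \sum_(l < n.+1) \sum_(i < l.+1) F i (l - i)%N.
Proof.
elim: n => [|k IHk]; first by rewrite !big_ord1.
rewrite [RHS]big_ord_recr -{}IHk big_ord_recr /= subnn big_ord1.
rewrite [\sum_(i < k.+2) _]big_ord_recr /= subnn addrA; congr (_ + _).
rewrite -big_split; apply: eq_bigr => i _ /=.
by rewrite subSn ?big_ord_recr // -ltnS.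
Qed.

Lemma exchange_triangle :
  \sum_(i < n.+1) \sum_(j < (n - i).+1) F i j =
  \sum_(j < n.+1) \sum_(i < (n - j).+1) F i j.
Proof.
(* Padding the inner ranges to [n.+1] under a guard leaves a condition symmetric in [i] and [j]. *)
under eq_bigr => i _ do
  rewrite (big_ord_widen n.+1 (F i)) ?ltnS ?leq_subr //.
under [RHS]eq_bigr => j _ do
  rewrite (big_ord_widen n.+1 (F ^~ j)) ?ltnS ?leq_subr //.
rewrite (exchange_big_dep xpredT) //=; apply: eq_bigr => j _.
apply: eq_bigl => i; rewrite !ltnS !leq_subRL -1?ltnS ?ltn_ord //.
by rewrite addnC.
Qed.

End TriangularSums.

(** * Power series in [h]: exponentials, conjugation by [e^(hA)], sums with a factor [h] *)

Section Fps.
Variables (R : realType) (Alg : algType R).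
Implicit Types (f g : fps Alg) (F G : nat -> fps Alg) (X Y A B : Alg).

Lemma fps_coefM f g n : (f * g) n = \sum_(i < n.+1) f i * g (n - i)%N.
Proof. by []. Qed.

Lemma fps_coefD f g n : (f + g) n = f n + g n.
Proof. by []. Qed.

Lemma fps_coefZ (c : R) f n : (c *: f) n = c *: f n.
Proof. by []. Qed.

Lemma fps_coef_mulX f X n : (f * fps_monom 0 X) n = f n * X.
Proof.
rewrite fps_coefM big_ord_recr /= subnn /fps_monom eqxx big1 ?add0r // => i _.
by rewrite subn_eq0 leqNgt ltn_ord mulr0.
Qed.

Lemma fps_coef_Xmul f X n : (fps_monom 0 X * f) n = X * f n.
Proof.
rewrite fps_coefM big_ord_recl /= subn0 /fps_monom eqxx big1 ?addr0 // => i _.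
by rewrite mul0r.
Qed.

Lemma fps_monomZ (c : R) n X : c *: fps_monom n X = fps_monom n (c *: X).
Proof.
by apply/funext => m; rewrite fps_coefZ /fps_monom; case: eqP; rewrite ?scaler0.
Qed.

Lemma fps_monom1X X n : (fps_monom 1 X : fps Alg) ^+ n = fps_monom n (X ^+ n).
Proof.
elim: n => [|n IHn]; first by rewrite !expr0.
apply/funext => -[|m]; rewrite exprS fps_coefM IHn /fps_monom.
  by rewrite big_ord1 mul0r.
rewrite !big_ord_recl /= mul0r add0r subn1 /= big1 ?addr0 => [|i _].
  by rewrite eqSS exprS; case: eqP; rewrite ?mulr0.
by rewrite mul0r.
Qed.

(** Only the term [k = n] of the exponential series reaches degree [n], so the infinite sum reduces
    to one term. *)
Lemma fps_exp_coef X n : fps_exp (fps_monom 1 X) n = (n`!%:R)^-1 *: X ^+ n.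
Proof.
rewrite /fps_exp /fps_sum (fsbigE [:: n]) //=.
- by rewrite big_mkcond big_seq1 in_setT fps_coefZ fps_monom1X /fps_monom eqxx.
- move=> k _; rewrite inE fps_coefZ fps_monom1X /fps_monom eq_sym.
  by move=> /negPf->; rewrite scaler0.
Qed.

Lemma bin_divf n i : (i <= n)%N ->
  'C(n, i)%:R / n`!%:R = (i`!%:R)^-1 * ((n - i)`!%:R)^-1 :> R.
Proof.
move=> le_in; rewrite -(bin_fact le_in) !natrM !invfM !mulrA mulfV ?mul1r //.
by rewrite pnatr_eq0 -lt0n bin_gt0.
Qed.

Lemma fps_expD A :
  fps_exp (fps_monom 1 A) * fps_exp (fps_monom 1 A) =
  fps_exp ((2 : R) *: fps_monom 1 A).
Proof.
apply/funext => n; rewrite fps_monomZ fps_coefM fps_exp_coef.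
have ->: ((2 : R) *: A) ^+ n = (2 : R) ^+ n *: A ^+ n.
  elim: n => [|n IHn]; first by rewrite !expr0 scale1r.
  by rewrite !exprS IHn -scalerAl -scalerAr scalerA.
(* Expanding [(1 + 1)^n] supplies the binomials of the Cauchy product. *)
have ->: (2 : R) ^+ n = \sum_(i < n.+1) 'C(n, i)%:R.
  rewrite -natrX -[2%N]/(1 + 1)%N expnDn natr_sum; apply: eq_bigr => i _.
  by rewrite !exp1n !muln1.
rewrite scalerA mulr_sumr scaler_suml; apply: eq_bigr => i _.
have le_in : (i <= n)%N by rewrite -ltnS.
rewrite !fps_exp_coef -scalerAl -scalerAr scalerA -exprD subnKC //.
by rewrite -bin_divf // mulrC.
Qed.

(* [Y A = A Y + ad_{-A} Y], and left multiplication by A commutes with ad_{-A}. *)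
Lemma mul_expr_ad A X n :
  X * A ^+ n = \sum_(j < n.+1) 'C(n, j)%:R *: (A ^+ (n - j) * ad (- A) j X).
Proof.
have adS j : ad (- A) j X * A = A * ad (- A) j X + ad (- A) j.+1 X.
  by rewrite /ad iterS /commutator mulNr mulrN opprK addrA addrN add0r.
elim: n => [|n IHn]; first by rewrite big_ord1 bin0 scale1r !expr0 mulr1 mul1r.
rewrite exprSr mulrA {}IHn mulr_suml [in RHS]big_ord_recl bin0 scale1r subn0.
(* Pascal's rule: its two halves match the two terms of [adS]. *)
under [in RHS]eq_bigr => j _ do rewrite lift0 binS natrD scalerDl.
rewrite big_split /= addrA.
have ->: A ^+ n.+1 * ad (- A) 0 X +
    \sum_(i < n.+1) 'C(n, i.+1)%:R *: (A ^+ (n.+1 - i.+1) * ad (- A) i.+1 X) =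
    \sum_(i < n.+2) 'C(n, i)%:R *: (A ^+ (n.+1 - i) * ad (- A) i X).
  by rewrite [in RHS]big_ord_recl bin0 scale1r subn0.
rewrite [\sum_(i < n.+2) _]big_ord_recr /= bin_small // scale0r addr0 -big_split.
apply: eq_bigr => j _ /=.
rewrite -scalerAl -mulrA adS mulrDr scalerDr [A ^+ _ * (A * _)]mulrA -exprSr.
by rewrite subSS subSn // -ltnS.
Qed.

(* [e^(-hA) (ad_{-A}^m B / m!) e^(hA)], which is [e^(ad_{-hA})] applied to
   [ad_{-A}^m B / m!]. *)
Definition fps_conj_tail A B m : fps Alg :=
  fun j => (m`!%:R * j`!%:R)^-1 *: ad (- A) (m + j) B.

(** Keeping the exponential on both sides avoids inverting it. Since [C(n, j) / n!] splits into
    [1 / j!] and [1 / (n - j)!], the expansion of [X * A ^+ n] becomes a Cauchy product. *)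
Lemma ad_mul_fps_exp A B m :
  fps_monom 0 ((m`!%:R)^-1 *: ad (- A) m B) * fps_exp (fps_monom 1 A) =
  fps_exp (fps_monom 1 A) * fps_conj_tail A B m.
Proof.
apply/funext => n; rewrite fps_coef_Xmul fps_coefM fps_exp_coef.
rewrite -scalerAl -scalerAr scalerA mul_expr_ad scaler_sumr.
rewrite (reindex_inj rev_ord_inj); apply: eq_bigr => j _ /=.
have le_jn : (j <= n)%N by rewrite -ltnS.
rewrite subSS subKn // scalerA fps_exp_coef /fps_conj_tail -scalerAl -scalerAr.
rewrite scalerA -mulrA bin_sub // [_ * 'C(n, j)%:R]mulrC bin_divf // invfM.
rewrite mulrCA; congr (_ *: (_ * _)).
by rewrite addnC /ad iterD.
Qed.

(* The series [\sum_m h^(m+1) F m]. *)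
Definition fps_hsum F : fps Alg :=
  fun n => if n is k.+1 then \sum_(m < k.+1) F m (k - m)%N else 0.

(** The factor [h^(m+1)] makes degree [n] depend on lower degrees only, which feeds the induction on
    degree in [mi_series_mul]. *)
Lemma eq_fps_hsum F G n :
  (forall m k, (k < n)%N -> F m k = G m k) -> fps_hsum F n = fps_hsum G n.
Proof.
by case: n => [//|n] eqFG; apply: eq_bigr => m _; rewrite eqFG // ltnS leq_subr.
Qed.

Lemma fps_hsumD F G : fps_hsum (fun m => F m + G m) = fps_hsum F + fps_hsum G.
Proof.
apply/funext => -[|n]; first by rewrite fps_coefD addr0.
by rewrite fps_coefD -big_split.
Qed.

Lemma fps_hsumZ (c : R) F : fps_hsum (fun m => c *: F m) = c *: fps_hsum F.
Proof.
apply/funext => -[|n]; first by rewrite fps_coefZ scaler0.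
by rewrite fps_coefZ scaler_sumr.
Qed.

(** Only [m <= n] reaches degree [n + 1], so distributing [g] is a finite regrouping by [m + k],
    where [k] is the degree taken in [F m]. *)
Lemma fps_hsum_mul F g : fps_hsum F * g = fps_hsum (fun m => F m * g).
Proof.
apply/funext => -[|n]; first by rewrite fps_coefM big_ord1 mul0r.
rewrite fps_coefM big_ord_recl mul0r add0r /=.
under [RHS]eq_bigr => m _ do rewrite fps_coefM.
rewrite (sum_antidiagonals n (fun m k => F m k * g (n - m - k)%N)).
apply: eq_bigr => i _; rewrite mulr_suml; apply: eq_bigr => m _ /=.
by rewrite -subnDA subnKC // -ltnS.
Qed.

Lemma fps_mul_hsum f F : f * fps_hsum F = fps_hsum (fun m => f * F m).
Proof.
apply/funext => -[|n]; first by rewrite fps_coefM big_ord1 mulr0.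
rewrite fps_coefM big_ord_recr /= subnn mulr0 addr0.
under [RHS]eq_bigr => m _ do rewrite fps_coefM.
rewrite -(exchange_triangle n (fun i m => f i * F m (n - m - i)%N)).
apply: eq_bigr => i _ /=; rewrite subSn ?mulr_sumr; last by rewrite -ltnS.
by apply: eq_bigr => m _; rewrite -!subnDA addnC.
Qed.

End Fps.

(** * Finite enumeration of the multi-indices of given weight *)

(** The fuel makes the recursion structural; a first entry [m] uses up [m + 1] of the weight [n]. *)
Fixpoint mi_enum (fuel n : nat) : seq multiindex :=
  match fuel, n with
  | _, 0 => [:: [::]]
  | 0, _ => [::]
  | k.+1, l.+1 => [seq m :: mu | m <- iota 0 l.+1, mu <- mi_enum k (l - m)]
  end.

Lemma mi_enumSS k l : mi_enum k.+1 l.+1 =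
  [seq m :: mu | m <- iota 0 l.+1, mu <- mi_enum k (l - m)].
Proof. by []. Qed.

Lemma mi_weight_cons m mu : mi_weight (m :: mu) = (m + mi_weight mu).+1.
Proof. by rewrite /mi_weight /= addSn addnCA. Qed.

(** Each entry costs at least one unit of weight, so fuel [k >= n] never runs out. *)
Lemma mem_mi_enum k n mu :
  (n <= k)%N -> (mu \in mi_enum k n) = (mi_weight mu == n).
Proof.
elim: k n mu => [|k IHk] [|n] [|m mu] le_nk //.
  by apply/negbTE/negP => /allpairsPdep [j [nu [_ _]]].
apply/allpairsPdep/eqP => [[j [nu [+ + [-> ->]]]]|].
  rewrite mem_iota ltnS => /andP [_ le_jn].
  rewrite IHk ?(leq_trans (leq_subr _ _)) // => /eqP wnu.
  by rewrite mi_weight_cons wnu subnKC.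
rewrite mi_weight_cons => -[wmu]; exists m, mu; split => //.
  by rewrite mem_iota ltnS -wmu leq_addr.
by rewrite IHk -wmu ?addKn // (leq_trans (leq_addl m _)) // wmu.
Qed.

Lemma mi_enum_uniq k n : uniq (mi_enum k n).
Proof.
elim: k n => [|k IHk] [|n] //.
apply: (allpairs_uniq_dep (f := fun m : nat => cons m)) => [|m _|];
  rewrite ?iota_uniq //.
by move=> [i x] [j y] _ _ /= [-> ->].
Qed.

(** * Products and conjugates of multi-index series *)

Section MultiIndexSeriesTheory.
Variables (R : realType) (Alg : algType R) (A B : Alg).
Implicit Types (alpha beta : multiindex -> R) (f : fps Alg).
Local Notation S := (mi_series A B).
Local Notation E := (fps_exp (fps_monom 1 A)).

(** Finitely many multi-indices have weight [n] and no other contributes in degree [n], so the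
    default value of the infinite sum never arises. *)
Lemma mi_series_enum alpha k n : (n <= k)%N ->
  S alpha n = \sum_(mu <- mi_enum k n)
    (alpha mu / (mi_fact mu)%:R) *: \prod_(m <- rev mu) ad (- A) m B.
Proof.
move=> le_nk; rewrite /mi_series /fps_sum (fsbigE (mi_enum k n)) ?mi_enum_uniq //=.
  rewrite big_mkcond big_seq [RHS]big_seq; apply: eq_bigr => mu.
  rewrite mem_mi_enum // => /eqP <-.
  by rewrite in_setT fps_coefZ /elem_diff /fps_monom eqxx.
move=> mu _; rewrite mem_mi_enum // fps_coefZ /elem_diff /fps_monom eq_sym.
by move/negPf->; rewrite scaler0.
Qed.

Lemma mi_seriesD alpha beta :
  S (fun mu => alpha mu + beta mu) = S alpha + S beta.
Proof.
apply/funext => n; rewrite fps_coefD !(mi_series_enum _ (leqnn n)) -big_split.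
by apply: eq_bigr => mu _; rewrite mulrDl scalerDl.
Qed.

Lemma mi_seriesZ c alpha : S (fun mu => c * alpha mu) = c *: S alpha.
Proof.
apply/funext => n; rewrite fps_coefZ !(mi_series_enum _ (leqnn n)) scaler_sumr.
by apply: eq_bigr => mu _; rewrite scalerA mulrA.
Qed.

Lemma mi_series0 : S (fun=> 0) = 0.
Proof.
apply/funext => n; rewrite (mi_series_enum _ (leqnn n)) big1 // => mu _.
by rewrite mul0r scale0r.
Qed.

Lemma mi_series_sum n (c : 'I_n -> R) (alpha : 'I_n -> multiindex -> R) :
  S (fun mu => \sum_(i < n) c i * alpha i mu) = \sum_(i < n) c i *: S (alpha i).
Proof.
elim: n c alpha => [|n IHn] c alpha.
  rewrite big_ord0 -mi_series0; congr mi_series.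
  by apply/funext => mu; rewrite big_ord0.
rewrite big_ord_recl -IHn -mi_seriesZ -mi_seriesD; congr mi_series.
by apply/funext => mu; rewrite big_ord_recl.
Qed.

Definition mi_coef m : fps Alg := fps_monom 0 ((m`!%:R)^-1 *: ad (- A) m B).

(* Multi-indices are split at their first entry, which is the rightmost factor
   of the elementary differential. *)
Lemma mi_series_rec alpha :
  S alpha = alpha [::] *: 1 +
    fps_hsum (fun m => S (fun mu => alpha (m :: mu)) * mi_coef m).
Proof.
apply/funext => -[|n]; rewrite fps_coefD fps_coefZ.
  rewrite (mi_series_enum _ (leqnn 0)) big_seq1 /mi_fact !big_nil divr1.
  by rewrite addr0.
have -> : (1 : fps Alg) n.+1 = 0 by [].
rewrite scaler0 add0r (mi_series_enum _ (leqnn n.+1)).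
rewrite mi_enumSS big_allpairs_dep -[iota 0 n.+1]/(index_iota 0 n.+1) big_mkord.
apply: eq_bigr => m _; rewrite fps_coef_mulX (@mi_series_enum _ n) ?leq_subr //.
rewrite mulr_suml; apply: eq_bigr => mu _.
rewrite /mi_fact big_cons rev_cons big_rcons /= -scalerAl -scalerAr scalerA.
by rewrite natrM invfM mulrA mulrAC.
Qed.

(** The convolution for deconcatenation alone, without the sum over [p]. *)
Definition mi_concat beta alpha (mu : multiindex) : R :=
  \sum_(i < (size mu).+1) beta (take i mu) * alpha (drop i mu).

Lemma mi_concat_cons beta alpha m :
  (fun mu => mi_concat beta alpha (m :: mu)) =
  (fun mu => beta [::] * alpha (m :: mu) +
             mi_concat (fun nu => beta (m :: nu)) alpha mu).
Proof. by apply/funext => mu; rewrite /mi_concat big_ord_recl. Qed.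

(** First entries are rightmost factors, so prefixes come from the right factor [S beta]. The
    induction on degree peels off the first entry [m] and replaces [beta] by
    [fun nu => beta (m :: nu)]. *)
Lemma mi_series_mul beta alpha : S alpha * S beta = S (mi_concat beta alpha).
Proof.
apply/funext => n; elim/ltn_ind: n beta => n IHn beta.
rewrite [S beta]mi_series_rec [S (mi_concat _ _)]mi_series_rec.
rewrite mulrDr -scalerAr mulr1 fps_mul_hsum.
under [X in _ = (_ + fps_hsum X) n]funext => m.
  rewrite mi_concat_cons mi_seriesD mi_seriesZ mulrDl -scalerAl.
  over.
rewrite fps_hsumD fps_hsumZ addrA.
(* The decompositions with empty prefix add up to [beta [::] *: S alpha]. *)
have ->: mi_concat beta alpha [::] *: 1 + beta [::] *:
    fps_hsum (fun m => S (fun mu => alpha (m :: mu)) * mi_coef m)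
    = beta [::] *: S alpha.
  by rewrite [S alpha]mi_series_rec scalerDr scalerA /mi_concat big_ord1.
rewrite !fps_coefD; congr (_ + _); apply: eq_fps_hsum => m k lt_kn.
by rewrite mulrA !fps_coef_mulX IHn.
Qed.

(** The finite range of [p] outside which [mi_setminus] vanishes. *)
Fixpoint mi_box (mu : multiindex) : seq multiindex :=
  if mu is m :: nu then [seq j :: p | j <- iota 0 m.+1, p <- mi_box nu]
  else [:: [::]].

Lemma mi_box_cons m mu :
  mi_box (m :: mu) = [seq j :: p | j <- iota 0 m.+1, p <- mi_box mu].
Proof. by []. Qed.

Definition mi_diff (mu p : multiindex) : multiindex :=
  [seq (x.1 - x.2)%N | x <- zip mu p].

(* The coefficient map of [e^(-hA) B(alpha) e^(hA)]. *)
Definition mi_shift alpha (mu : multiindex) : R :=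
  \sum_(p <- mi_box mu) (mi_binom mu p)%:R * alpha (mi_diff mu p).

Lemma mi_shift_cons alpha m :
  (fun mu => mi_shift alpha (m :: mu)) =
  (fun mu => \sum_(j < m.+1) 'C(m, j)%:R *
     mi_shift (fun nu => alpha ((m - j)%N :: nu)) mu).
Proof.
apply/funext => mu; rewrite /mi_shift mi_box_cons big_allpairs_dep.
rewrite -[iota 0 m.+1]/(index_iota 0 m.+1) big_mkord; apply: eq_bigr => j _.
rewrite mulr_sumr; apply: eq_bigr => p _.
by rewrite /mi_binom /= big_cons natrM mulrA.
Qed.

(** The exponential passes the rightmost letter by [ad_mul_fps_exp], then the remaining series by
    induction, in a lower degree. *)
Lemma mi_series_mul_exp alpha : S alpha * E = E * S (mi_shift alpha).
Proof.
apply/funext => n; elim/ltn_ind: n alpha => n IHn alpha.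
rewrite [S alpha]mi_series_rec [S (mi_shift _)]mi_series_rec.
rewrite mulrDl mulrDr -scalerAl -scalerAr mul1r mulr1 !fps_coefD.
congr (_ + _).
  by rewrite /mi_shift big_seq1 /mi_binom big_nil mul1r.
rewrite fps_hsum_mul fps_mul_hsum; case: n IHn => [//|n] IHn.
pose F (m : nat) := S (fun mu => alpha (m :: mu)) * E.
transitivity (\sum_(m < n.+1) \sum_(j < (n - m).+1)
  F m (n - m - j)%N * fps_conj_tail A B m j).
  apply: eq_bigr => m _; rewrite -mulrA ad_mul_fps_exp mulrA fps_coefM.
  rewrite (reindex_inj rev_ord_inj); apply: eq_bigr => j _ /=.
  by rewrite subSS subKn // -ltnS.
(* Regrouping by [l = m + j], the entry [m] once raised by [j]. *)
rewrite (sum_antidiagonals n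
  (fun m j => F m (n - m - j)%N * fps_conj_tail A B m j)).
apply: eq_bigr => l _; rewrite mulrA fps_coef_mulX mi_shift_cons.
rewrite mi_series_sum mulr_sumr.
have le_ord (k : nat) (i : 'I_k.+1) : (i <= k)%N by rewrite -ltnS.
have -> : (\sum_(j < l.+1) E * ('C(l, j)%:R *:
   S (mi_shift (fun nu => alpha ((l - j)%N :: nu))))) (n - l)%N =
   \sum_(j < l.+1) 'C(l, j)%:R *:
   F (l - j)%N (n - l)%N.
  elim/big_rec2: _ => [//|j x y _ <-]; rewrite fps_coefD -scalerAr fps_coefZ.
  by rewrite -IHn // ltnS leq_subr.
(* With [m = l - j], the factor [1 / ((l - j)! j!)] of the tail equals [C(l, j) / l!]. *)
rewrite (reindex_inj rev_ord_inj) mulr_suml; apply: eq_bigr => j _ /=.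
rewrite subSS subKn // -subnDA subnK // /fps_conj_tail subnK //.
by rewrite -scalerAl -!scalerAr scalerA invfM mulrC -bin_divf.
Qed.

End MultiIndexSeriesTheory.

(** * The coproduct as a finite sum and its evaluation *)

Lemma mem_mi_box mu p : (p \in mi_box mu) = all2 leq p mu.
Proof.
elim: mu p => [|m mu IHmu] [|j p]; rewrite ?mi_box_cons //.
  by apply/negbTE/negP => /allpairsPdep [i [nu [_ _]]].
rewrite [RHS]/= -IHmu; apply/allpairsPdep/andP => [[i [q [+ + [-> ->]]]]|[le_jm pmu]].
  by rewrite mem_iota ltnS => /andP [_ ->].
by exists j, p; rewrite mem_iota ltnS.
Qed.

Lemma mi_box_uniq mu : uniq (mi_box mu).
Proof.
elim: mu => [//|m mu IHmu].
apply: (allpairs_uniq_dep (f := fun j : nat => cons j)) => [|j _|];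
  rewrite ?iota_uniq //.
by move=> [i x] [j y] _ _ /= [-> ->].
Qed.

Section CoproductTheory.
Variable R : realType.
Implicit Types (alpha beta : multiindex -> R).
Implicit Type x : {malg R[(multiindex * multiindex)%type]}.

(** Supports can shrink by cancellation; a common larger set lets evaluations be compared
    termwise. *)
Lemma tens_evalw beta alpha x (d : {fset multiindex * multiindex}) :
  (msupp x `<=` d)%fset ->
  tens_eval beta alpha x = \sum_(k <- d) x@_k * (beta k.1 * alpha k.2).
Proof.
move=> sub_xd; rewrite /tens_eval; apply: big_fset_incl => // k _ kNx.
by rewrite mcoeff_outdom // mul0r.
Qed.

Lemma tens_evalD beta alpha x y :
  tens_eval beta alpha (x + y) = tens_eval beta alpha x + tens_eval beta alpha y.
Proof.
rewrite (tens_evalw _ _ (msuppD_le x y)) (tens_evalw _ _ (fsubsetUl _ (msupp y))).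
rewrite (tens_evalw _ _ (fsubsetUr (msupp x) _)) -big_split.
by apply: eq_bigr => k _; rewrite mcoeffD mulrDl.
Qed.

Lemma tens_evalZ beta alpha c x :
  tens_eval beta alpha (c *: x) = c * tens_eval beta alpha x.
Proof.
rewrite (tens_evalw _ _ (msuppZ_le c x)) /tens_eval mulr_sumr.
by apply: eq_bigr => k _; rewrite mcoeffZ -mulrA.
Qed.

Lemma tens_eval0 beta alpha : tens_eval beta alpha 0 = 0.
Proof. by rewrite /tens_eval msupp0 big_seq_fset0. Qed.

Lemma tens_eval_sum beta alpha (I : Type) (r : seq I)
    (F : I -> {malg R[(multiindex * multiindex)%type]}) :
  tens_eval beta alpha (\sum_(i <- r) F i) =
  \sum_(i <- r) tens_eval beta alpha (F i).
Proof.
exact: (big_morph _ (tens_evalD beta alpha) (tens_eval0 beta alpha)).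
Qed.

Lemma tensU (mu nu : multiindex) :
  tens << mu >> << nu >> = << (mu, nu) >>
    :> {malg R[(multiindex * multiindex)%type]}.
Proof. by rewrite /tens !msuppU !oner_eq0 !big_seq_fset1 !mcoeffUU mulr1. Qed.

Lemma tens_evalU beta alpha (mu nu : multiindex) :
  tens_eval beta alpha << (mu, nu) >> = beta mu * alpha nu.
Proof. by rewrite /tens_eval msuppU oner_eq0 big_seq_fset1 mcoeffUU mul1r. Qed.

Lemma coproduct_box (mu : multiindex) :
  coproduct R mu = \sum_(i < (size mu).+1) \sum_(p <- mi_box (drop i mu))
    (mi_binom (drop i mu) p)%:R *:
      << (take i mu : multiindex, mi_diff (drop i mu) p) >>.
Proof.
apply: eq_bigr => i _ /=; move: (take i mu) (drop i mu) => mu1 mu2.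
rewrite (fsbigE (pmap insub (mi_box mu2))) //=; last first.
- move=> p _; rewrite mem_pmap_sub mem_mi_box /mi_setminus => /negPf ->.
  by rewrite /tens msupp0 big1 ?scaler0 // => k _; rewrite big_seq_fset0.
- by rewrite pmap_sub_uniq // mi_box_uniq.
under eq_bigl do rewrite in_setT.
rewrite -(big_map val xpredT
  (fun p => (mi_binom mu2 p)%:R *: tens << mu1 >> (mi_setminus R mu2 p))).
rewrite pmap_filter; last exact: insubK.
pose to_tuple : seq nat -> option ((size mu2).-tuple nat) := insub.
(* Every element of the box has the length of [mu2], so the passage to tuples discards nothing. *)
have /all_filterP -> : all (isSome \o to_tuple) (mi_box mu2).
  apply/allP => p; rewrite mem_mi_box all2E => /andP [/eqP sz_p _].
  by rewrite /= /to_tuple insubT ?sz_p.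
rewrite big_seq [RHS]big_seq; apply: eq_bigr => p.
by rewrite mem_mi_box /mi_setminus => ->; rewrite tensU.
Qed.

(** For each cut, the sum over [p] acts on the second piece only and is thus [mi_shift alpha]
    there. *)
Lemma mi_convolutionE beta alpha :
  mi_convolution beta alpha = mi_concat beta (mi_shift alpha).
Proof.
apply/funext => mu; rewrite /mi_convolution coproduct_box tens_eval_sum.
apply: eq_bigr => i _; rewrite tens_eval_sum mulr_sumr.
by apply: eq_bigr => p _; rewrite tens_evalZ tens_evalU mulrCA.
Qed.

End CoproductTheory.

Theorem theorem4p3 (R : realType) (Alg : algType R) (A B : Alg)
    (Phi Psi : fps Alg) (alpha1 alpha2 : multiindex -> R) :
  splitting_method A B Phi ->
  splitting_method A B Psi ->
  Phi = fps_exp (fps_monom 1 A) * mi_series A B alpha1 ->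
  Psi = fps_exp (fps_monom 1 A) * mi_series A B alpha2 ->
  Phi * Psi =
    fps_exp (2 *: fps_monom 1 A)
    * mi_series A B (mi_convolution alpha2 alpha1).
Proof.
move=> _ _ -> ->; rewrite mi_convolutionE -mi_series_mul -fps_expD.
(* With the leftmost [e^(hA)] removed, the middle one moves left past [B(alpha1)]. *)
by rewrite -!mulrA; congr (_ * _); rewrite !mulrA mi_series_mul_exp.
Qed.
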